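(* Let $X$ be an even-dimensional real vector space endowed with a gauge $\gamma$ and a symplectic form $\omega$; let $\gamma_\omega$ be the dual gauge of $\gamma$, and let $\dashv$ and $\dashv_\omega$ be the orthogonality relations given by $\gamma$ and $\gamma_\omega$. Let $x,y\in X$ be non-zero vectors. If $y\dashv_\omega\{x\}^\perp$ and $\omega(x,y)>0$, then $-x\dashv\{y\}^\perp$.
   Context: All vector spaces are finite-dimensional. A gauge on a real vector space $X$ is a function $\gamma:X\to\mathbb{R}$ with $\gamma(x)\ge 0$ and equality iff $x=0$, $\gamma(\alpha x)=\alpha\gamma(x)$ for $\alpha\ge0$, and $\gamma(x+y)\le\gamma(x)+\gamma(y)$ (symmetry is not assumed). Its unit ball is $K=\{x:\gamma(x)\le1\}$. A symplectic form $\omega$ is a nondegenerate skew-symmetric bilinear form on $X$. It gives an isomorphism $\mathcal{I}:X^*\to X$ determined by $f(\cdot)=\omega(\mathcal{I}(f),\cdot)$. With $K^\circ=\{f\in X^*: f(x)\le1\ \forall x\in K\}$, the dual body is $K^\omega=\mathcal{I}(K^\circ)$, and the dual gauge $\gamma_\omega$ is the gauge with unit ball $K^\omega$, i.e. $\gamma_\omega(x)=\inf\{\lambda\ge0:x\in\lambda K^\omega\}$. For a gauge $\delta$ on $X$, $x$ is orthogonal to $y$ with respect to $\delta$ if $\delta(x)\le\delta(x+ty)$ for all $t\in\mathbb{R}$; $x$ is orthogonal to a hyperplane $H$ (a linear subspace of codimension one) if $x$ is orthogonal to every $z\in H$. For non-zero $x$, $\{x\}^\perp=\{z\in X:\omega(x,z)=0\}$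 (symplectic complement). *)

(* Defs.v *)
From HB Require Import structures.
From mathcomp Require Import all_boot all_order all_algebra.
From mathcomp Require Import all_classical all_reals.

Set Implicit Arguments.
Unset Strict Implicit.
Unset Printing Implicit Defensive.

Import Order.TTheory GRing.Theory Num.Theory.

Local Open Scope classical_set_scope.
Local Open Scope ring_scope.

Section Gauges.
Variables (R : realType) (X : vectType R).

Record is_gauge (g : X -> R) : Prop := IsGauge {
  gauge_ge0 : forall x, 0 <= g x;
  gauge_eq0 : forall x, g x = 0 <-> x = 0;
  gaugeZ : forall (a : R) x, 0 <= a -> g (a *: x) = a * g x;
  gaugeD : forall x y, g (x + y) <= g x + g y }.

Definition unit_ball (g : X -> R) : set X := [set x | g x <= 1].

Definition polar (K : set X) : set 'Hom(X, R^o) :=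
  [set f | forall x, K x -> (f x : R) <= 1].

Definition minkowski_functional (K : set X) (x : X) : R :=
  inf [set l : R | 0 <= l /\ [set l *: k | k in K] x].

Definition gauge_orth (d : X -> R) (x y : X) : Prop :=
  forall t : R, d x <= d (x + t *: y).

Definition gauge_orth_subspace (d : X -> R) (x : X) (H : {vspace X}) : Prop :=
  forall z, z \in H -> gauge_orth d x z.

End Gauges.

Section Symplectic.
Variables (R : realType) (X : vectType R) (w : {skew_symmetric X}).

(* The default value 0 is irrelevant when [w] is nondegenerate: the vector
   exists and is unique by [symp_isoE] and [symp_iso_unique] below. *)
Definition symp_iso (f : 'Hom(X, R^o)) : X :=
  xget 0 [set v | forall z, f z = w v z].

Definition dual_body (K : set X) : set X := symp_iso @` polar K.

Definition dual_gauge (g : X -> R) : X -> R :=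
  minkowski_functional (dual_body (unit_ball g)).

(* [orthov] puts its vectors in the first argument of the form; by skew
   symmetry this is {z | w x z = 0}, see [mem_symp_compl]. *)
Definition symp_compl (x : X) : {vspace X} := orthov w <[x]>.

Lemma skewE u v : w u v = - w v u.
Proof.
have -> : w u v = (-1) ^+ true * w v u by exact: hermitian_subproof.
by rewrite expr1 mulN1r.
Qed.

Lemma mem_symp_compl x z : (z \in symp_compl x) = (w x z == 0).
Proof. by rewrite /symp_compl mem_orthov1 skewE oppr_eq0. Qed.

Hypothesis w_symp : is_psymplectic w.

Lemma symp_nondeg v : (forall z, w v z = 0) -> v = 0.
Proof.
move=> wv0; have [/eqP w0 _ _] := w_symp.
by apply/eqP; rewrite -memv0 -w0; apply/mem_orthovP => z _.
Qed.

Lemma dim_symp_compl x : x != 0 -> (\dim (symp_compl x)).+1 = \dim {:X}.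
Proof.
move=> x0; have [/eqP w0 _ _] := w_symp.
have xN : x \notin orthov w fullv by rewrite w0 memv0.
have := eq_dim_orthov1 xN; rewrite capfv /symp_compl => <-.
rewrite prednK // lt0n dimv_eq0; apply: contraNneq x0 => X0.
by rewrite -memv0 -X0 memvf.
Qed.

Lemma symp_iso_unique v v' : (forall z, w v z = w v' z) -> v = v'.
Proof.
move=> e; apply/eqP; rewrite -subr_eq0; apply/eqP/symp_nondeg => z.
by rewrite linearBl /= e subrr.
Qed.

Let wrP v (a : R) u u' : w v (a *: u + u') = a * w v u + w v u'.
Proof.
have wB z z' : w v (z - z') = w v z - w v z' by exact: zmod_morphismr_subproof.
have wZ z : w v (a *: z) = a * w v z by exact: linearr_subproof.
have w0 : w v 0 = 0 by have := wB 0 0; rewrite !subrr.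
have wN z : w v (- z) = - w v z by have := wB 0 z; rewrite w0 !sub0r.
by rewrite -[u' in LHS]opprK wB wN opprK wZ.
Qed.

Let wr_linear v : linear (w v : X -> R^o).
Proof. by move=> a u u'; exact: wrP. Qed.

Let flat (v : X) : 'Hom(X, R^o) := linfun (w v : X -> R^o).

Let flatE v z : flat v z = w v z.
Proof.
pose fL : {linear X -> R^o} :=
  HB.pack (w v : X -> R^o) (GRing.isLinear.Build R X R^o *:%R _ (wr_linear v)).
exact: (lfunE fL).
Qed.

Let flat_linear : linear flat.
Proof.
move=> a u v; apply/lfunP => z.
by rewrite add_lfunE scale_lfunE !flatE [LHS]skewE wrP opprD -mulrN -!skewE.
Qed.

Lemma symp_isoE (f : 'Hom(X, R^o)) z : f z = w (symp_iso f) z.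
Proof.
suff [v vP] : exists v, forall z, f z = w v z.
  by apply: (@xgetPex X 0 [set v | forall z, f z = w v z]); exists v.
pose F : {linear X -> 'Hom(X, R^o)} :=
  HB.pack flat (GRing.isLinear.Build R X 'Hom(X, R^o) *:%R _ flat_linear).
have kF : lker (linfun F) == 0%VS.
  apply/lker0P => u v; rewrite !lfunE /= => e; apply: symp_iso_unique => t.
  by rewrite -!flatE e.
have iF : limg (linfun F) = fullv.
  apply/eqP; rewrite eqEdim subvf /= limg_dim_eq; last first.
    by rewrite (eqP kF) capv0.
  by rewrite !dimvf /dim /= muln1.
have /memv_imgP[v _ ->] : f \in limg (linfun F) by rewrite iF memvf.
by exists v => t; rewrite lfunE /= flatE.
Qed.

End Symplectic.

(* Main.v *)
(** By Hahn-Banach there is [v] with [w v _ <= g] everywhere and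
    [w v (- x) = g (- x)].  The multiple [c v] with [c = w x y / g (- x)] lies
    in [y + {x}^perp] and has dual gauge at most [c], so orthogonality of [y]
    gives [dual_gauge w g y <= c].  For [z] in [{y}^perp] we then get
    [w x y = w y (- x + t z) <= dual_gauge w g y * g (- x + t z)
     <= c * g (- x + t z)], that is, [g (- x) <= g (- x + t z)]. *)
From HB Require Import structures.
Require Import Defs.
From mathcomp Require Import all_boot all_order all_algebra.
From mathcomp Require Import all_classical all_reals all_analysis.
From mathcomp Require Import ring lra.
Set Implicit Arguments.
Unset Strict Implicit.
Unset Printing Implicit Defensive.
Import Order.TTheory GRing.Theory Num.Theory.
Import numFieldNormedType.Exports. 
Import VectorInternalTheory.
Local Open Scope ring_scope.

(** * Sublinear functions and a finite-dimensional Hahn-Banach theorem *)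

Record sublinear (R : realType) (V : lmodType R) (p : V -> R) : Prop :=
  Sublinear {
    sublinearZ : forall (a : R) x, 0 <= a -> p (a *: x) = a * p x;
    sublinearD : forall x y, p (x + y) <= p x + p y }.

Section HahnBanach.
Context {R : realType} {V : lmodType R}.
Implicit Types (p q : V -> R) (u v x : V).

Lemma sublinear0 p : sublinear p -> p 0 = 0.
Proof. by move=> sp; rewrite -(scale0r 0) (sublinearZ sp)// mul0r. Qed.

Lemma sublinear_sum p (I : Type) (s : seq I) (F : I -> V) : sublinear p ->
  p (\sum_(i <- s) F i) <= \sum_(i <- s) p (F i).
Proof.
move=> sp; elim: s => [|i s IH]; first by rewrite !big_nil sublinear0.
by rewrite !big_cons (le_trans (sublinearD sp _ _))// lerD2l.
Qed.

Lemma sublinearN_ge p x : sublinear p -> - p (- x) <= p x.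
Proof.
move=> sp; have := sublinearD sp x (- x).
by rewrite subrr (sublinear0 sp); lra.
Qed.

(* The largest sublinear function below [p] that is at most [- p v] at [- v]. *)
Definition reduct p v x : R :=
  inf [set p (x + t *: v) - t * p v | t in [set t : R | 0 <= t]]%classic.

Lemma reduct_le p v x t : sublinear p -> 0 <= t ->
  reduct p v x <= p (x + t *: v) - t * p v.
Proof.
move=> sp t0; apply: ge_inf; last by exists t.
(* Subadditivity bounds the set below by [- p (- x)], so the infimum is a genuine one. *)
exists (- p (- x)) => _ [s s0 <-].
have := sublinearD sp (x + s *: v) (- x).
by rewrite addrC addKr (sublinearZ sp)//; lra.
Qed.

Lemma reduct_ge p v x c :
  (forall t, 0 <= t -> c <= p (x + t *: v) - t * p v) -> c <= reduct p v x.
Proof.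
move=> cP; apply: lb_le_inf; first by exists (p (x + 0 *: v) - 0 * p v), 0 => /=.
by move=> _ [t t0 <-]; exact: cP.
Qed.

(** The substitution of [t / a] for [t] gives one half of homogeneity, and the same for [a^-1] the
    other half. For subadditivity, parameters [s] for [x] and [t] for [y] combine into [s + t] for
    [x + y]. *)
Lemma reduct_sublinear p v : sublinear p -> sublinear (reduct p v).
Proof.
move=> sp.
have posZ a x : 0 < a -> a * reduct p v x <= reduct p v (a *: x).
  move=> a0; apply: reduct_ge => t t0.
  have ta0 : 0 <= t / a by rewrite divr_ge0 // ltW.
  have aE : a *: x + t *: v = a *: (x + (t / a) *: v).
    by rewrite scalerDr scalerA mulrCA divff ?gt_eqF// mulr1.
  rewrite aE (sublinearZ sp) ?(ltW a0)//.
  have -> : t * p v = a * (t / a * p v) by field; rewrite gt_eqF.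
  by rewrite -mulrBr ler_pM2l//; exact: reduct_le.
split=> [a x|x y].
  rewrite le_eqVlt => /predU1P[<-|a0].
    rewrite scale0r mul0r; apply/eqP; rewrite eq_le; apply/andP; split.
      by rewrite (le_trans (reduct_le _ _ sp (lexx 0)))// scale0r addr0 mul0r
        sublinear0// subr0.
    by apply: reduct_ge => t t0; rewrite add0r (sublinearZ sp)// subrr.
  apply/eqP; rewrite eq_le posZ// andbT.
  rewrite -ler_pdivrMl//; have := posZ a^-1 (a *: x).
  by rewrite invr_gt0 scalerA mulVf ?gt_eqF// scale1r; apply.
suff : reduct p v (x + y) - reduct p v y <= reduct p v x by rewrite lerBlDr.
apply: reduct_ge => s s0; rewrite lerBlDr -lerBlDl.
apply: reduct_ge => t t0; rewrite lerBlDl.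
apply: le_trans (reduct_le _ _ sp (addr_ge0 s0 t0)) _.
have := sublinearD sp (x + s *: v) (y + t *: v).
by rewrite addrACA -scalerDl mulrDl; lra.
Qed.

Lemma reduct_le_id p v x : sublinear p -> reduct p v x <= p x.
Proof.
by move=> sp; have := reduct_le v x sp (lexx 0); rewrite scale0r addr0 mul0r subr0.
Qed.

Lemma reductN p v : sublinear p -> reduct p v (- v) <= - p v.
Proof.
move=> sp; have := reduct_le v (- v) sp ler01.
by rewrite scale1r addNr mul1r sublinear0// sub0r.
Qed.

(** Reducing at the vectors of [s] one after another replaces Zorn's lemma. Each reduction only
    lowers the function, so the bound [- p v] at [- v] obtained earlier survives, and
    [- p v <= - q v]. *)
Lemma exists_sublinear_odd p (s : seq V) : sublinear p ->
  exists q, [/\ sublinear q, forall x, q x <= p x &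
    forall v, v \in s -> q (- v) <= - q v].
Proof.
elim: s p => [|v s IH] p sp; first by exists p; split.
have [q [sq qp qs]] := IH _ (reduct_sublinear v sp).
exists q; split => // [x|u].
  exact: le_trans (qp x) (reduct_le_id _ _ sp).
rewrite inE => /predU1P[->|]; last exact: qs.
apply: le_trans (qp _) (le_trans (reductN v sp) _).
by rewrite lerN2; exact: le_trans (qp v) (reduct_le_id _ _ sp).
Qed.

End HahnBanach.

(** Oddness reverses subadditivity: [q x <= q (x + y) + q (- y) = q (x + y) - q y]. It also carries
    homogeneity over to negative scalars. *)
Lemma sublinear_odd_linear (R : realType) (V : lmodType R) (q : V -> R) :
  sublinear q -> (forall x, q (- x) <= - q x) -> linear (q : V -> R^o).
Proof.
move=> sq qN.
have qNE x : q (- x) = - q x.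
  by apply/eqP; rewrite eq_le qN lerNl sublinearN_ge.
have qD x y : q (x + y) = q x + q y.
  apply/eqP; rewrite eq_le (sublinearD sq) /=.
  by have := sublinearD sq (x + y) (- y); rewrite addrK qNE; lra.
move=> a x y; rewrite qD; congr (_ + _).
have [a0|a0] := leP 0 a; first exact: sublinearZ.
rewrite -[a in LHS]opprK scaleNr qNE (sublinearZ sq) ?oppr_ge0 ?ltW//.
by rewrite mulNr opprK.
Qed.

Lemma linear_hom (R : realType) (X : vectType R) (q : X -> R) :
  linear (q : X -> R^o) -> exists f : 'Hom(X, R^o), forall x, f x = q x.
Proof.
move=> lq; pose F : {linear X -> R^o} :=
  HB.pack (q : X -> R^o) (GRing.isLinear.Build R X R^o *:%R _ lq).
by exists (linfun F) => x; exact: lfunE.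
Qed.

Lemma supporting_functional (R : realType) (X : vectType R) (p : X -> R) x :
  sublinear p ->
  exists f : 'Hom(X, R^o), (forall z, f z <= p z :> R) /\ f x = p x.
Proof.
(* Reducing at [x] first forces [q (- x) <= - p x], hence [q x >= p x]; the basis vectors then make
   [q] linear. *)
move=> sp; have [q [sq qp qb]] :=
  exists_sublinear_odd (vbasis {:X}) (reduct_sublinear x sp).
have sodd z : q (- z) <= - q z.
  have qbZ a b : b \in vbasis {:X} -> q (- (a *: b)) = - q (a *: b).
    move=> /qb qNb.
    have qNbE : q (- b) = - q b.
      by apply/eqP; rewrite eq_le qNb lerNl sublinearN_ge.
    have [a0|/ltW a0] := leP 0 a.
      by rewrite -scalerN !(sublinearZ sq)// qNbE mulrN.
    rewrite -scaleNr (sublinearZ sq) ?oppr_ge0//.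
    rewrite -[a in RHS]opprK scaleNr -scalerN (sublinearZ sq) ?oppr_ge0//.
    by rewrite qNbE; ring.
  have bE := coord_vbasis (memvf z).
  (* Oddness on the basis lines suffices: subadditivity is applied once to the expansion of [- z]
     and once to that of [z]. *)
  have sumN :
      q (- z) <= - \sum_i q (coord (vbasis {:X}) i z *: (vbasis {:X})`_i).
    rewrite {1}bE -sumrN (le_trans (sublinear_sum _ _ sq))// -sumrN ler_sum//.
    by move=> i _; rewrite qbZ// mem_nth// size_tuple.
  apply: le_trans sumN _; rewrite lerN2 {1}bE.
  exact: sublinear_sum.
have [f fE] := linear_hom (sublinear_odd_linear sq sodd).
exists f; split => [z|]; rewrite fE.
  exact: le_trans (qp z) (reduct_le_id _ _ sp).
apply/eqP; rewrite eq_le (le_trans (qp x) (reduct_le_id _ _ sp)) /=.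
have := sublinearN_ge x sq; have := le_trans (qp (- x)) (reductN x sp).
lra.
Qed.

(** * Boundedness and continuity of sublinear functions, and comparison with a gauge *)

Lemma sublinear_rV_bounded (R : realType) n (p : 'rV[R]_n -> R) :
  sublinear p -> exists2 M, 0 <= M & forall u, p u <= M * `|u|.
Proof.
move=> sp.
(* Coordinates may have either sign and [p] need not be even, so both [delta_mx 0 i] and its
   opposite contribute. *)
pose m (i : 'I_n) := `|p (delta_mx 0 i)| + `|p (- delta_mx 0 i)|.
exists (\sum_i m i) => [|u]; first by apply: sumr_ge0 => i _; rewrite addr_ge0.
rewrite {1}(row_sum_delta u) (le_trans (sublinear_sum _ _ sp))// mulr_suml.
apply: ler_sum => i _.
have ui : `|u 0 i| <= `|u|.
  rewrite [leRHS]/Num.norm /= mx_normrE.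
  exact: (le_bigmax _ (fun ij => `|u ij.1 ij.2|) (0, i)).
have m0 : 0 <= m i by rewrite addr_ge0.
apply: le_trans (ler_wpM2l m0 ui).
rewrite mulrC.
have [a0|a0] := leP 0 (u 0 i).
  rewrite (sublinearZ sp)// ger0_norm// ler_wpM2l//.
  by rewrite (le_trans (ler_norm _))// lerDl.
have -> : u 0 i *: delta_mx 0 i = - u 0 i *: - delta_mx 0 i :> 'rV[R]_n.
  by rewrite scaleNr scalerN opprK.
have Na0 : 0 <= - u 0 i by rewrite oppr_ge0 ltW.
rewrite (sublinearZ sp)// ltr0_norm// ler_wpM2l//.
by rewrite (le_trans (ler_norm _))// lerDr.
Qed.

(** Both differences of [p u] and [p v] are at most [p] of the corresponding difference of vectors,
    so [p] is Lipschitz. *)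
Lemma sublinear_rV_continuous (R : realType) n (p : 'rV[R]_n -> R) :
  sublinear p -> continuous p.
Proof.
move=> sp u; have [M M0 pM] := sublinear_rV_bounded sp.
have FF : Filter (nbhs u) by exact: nbhs_filter.
apply/cvgrPdist_le => e e0.
(* [M] may vanish, so the radius is [e / (M + 1)]. *)
have M1 : 0 < M + 1 by rewrite ltr_wpDl.
near=> v.
have uv : (M + 1) * `|u - v| <= e.
  rewrite -ler_pdivlMl// mulrC; near: v.
  by apply: (@cvgr_dist_le _ _ _ _ _ id); [exact: cvg_id|exact: divr_gt0].
have Muv : M * `|u - v| <= e.
  by apply: le_trans uv; rewrite ler_wpM2r// lerDl.
rewrite ler_norml; apply/andP; split.
  have := sublinearD sp u (v - u); rewrite addrC subrK.
  by have := pM (v - u); rewrite distrC; lra.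
have := sublinearD sp v (u - v); rewrite addrC subrK.
by have := pM (u - v); lra.
Unshelve. all: by end_near. Qed.

Lemma gauge_sublinear (R : realType) (X : vectType R) (g : X -> R) :
  is_gauge g -> sublinear g.
Proof. by move=> hg; split; [exact: gaugeZ | exact: gaugeD]. Qed.

Lemma gauge_gt0 (R : realType) (X : vectType R) (g : X -> R) x :
  is_gauge g -> x != 0 -> 0 < g x.
Proof.
move=> hg x0; rewrite lt_neqAle (gauge_ge0 hg) andbT eq_sym.
by apply: contra_neq x0 => /(gauge_eq0 hg).
Qed.

(* The gauge attains a positive minimum on the unit sphere of a norm. *)
Lemma sublinear_le_gauge (R : realType) (X : vectType R) (g p : X -> R) :
  is_gauge g -> sublinear p ->
  exists2 C, 0 < C & forall x, p x <= C * g x.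
Proof.
move=> hg sp; have sg := gauge_sublinear hg.
(* Coordinates move the problem to row vectors, which carry a norm with a compact unit sphere. *)
have sr (q : X -> R) : sublinear q -> sublinear (q \o @r2v R X).
  move=> sq; split => [a u a0|u v] /=.
    by rewrite linearZ /= (sublinearZ sq).
  by rewrite linearD /= (sublinearD sq).
have [M M0 pM] := sublinear_rV_bounded (sr _ sp).
pose S := [set u : 'rV[R]_(dim X) | `|u| = 1]%classic.
(* The sphere is empty only when the space is zero. *)
have [S0|/set0P SN] := eqVneq S set0%classic.
  exists 1 => // x; suff -> : x = 0.
    by rewrite (sublinear0 sp) (sublinear0 sg) mulr0.
  apply: (can_inj v2rK); rewrite linear0; apply/eqP/negPn/negP => x0.
  have : S (`|v2r x|^-1 *: v2r x).
    by rewrite /S /= normrZ normfV normr_id mulVf ?normr_eq0.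
  by rewrite S0.
have cS : compact S.
  apply: bounded_closed_compact.
    by exists 1; split => // a a1 u /= ->; exact: ltW.
  have -> : S = (Num.norm @^-1` [set 1 : R])%classic by [].
  apply: closed_comp; last exact: closed_eq.
  by move=> u _; exact: norm_continuous.
have gc := sublinear_rV_continuous (sr _ sg).
have [u Su umin] := EVT_min_rV SN cS (continuous_subspaceT gc).
move: Su; rewrite inE => Su.
have c0 : 0 < g (r2v u).
  apply: gauge_gt0 => //; apply: contra_eq_neq Su => /(congr1 v2r).
  by rewrite r2vK linear0 => ->; rewrite normr0 eq_sym oner_eq0.
have gmin x : g (r2v u) * `|v2r x| <= g x.
  have [x0|x0] := eqVneq (v2r x) 0.
    by rewrite x0 normr0 mulr0 (gauge_ge0 hg).
  have n0 : 0 < `|v2r x| by rewrite normr_gt0.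
  rewrite -ler_pdivlMr// mulrC.
  have := umin (`|v2r x|^-1 *: v2r x).
  rewrite /= linearZ /= v2rK (gaugeZ hg) ?invr_ge0//; apply.
  by rewrite inE /S /= normrZ normfV normr_id mulVf ?normr_eq0.
(* The bound [M] on [p] is divided by the minimum of [g] on the sphere; adding 1 keeps the constant
   positive. *)
exists ((M + 1) / g (r2v u)) => [|x]; first by rewrite divr_gt0// ltr_wpDl.
rewrite -[x in p x]v2rK (le_trans (pM _))// -mulrA.
apply: ler_pM => //; first by rewrite lerDl.
by rewrite ler_pdivlMl.
Qed.

(** * The dual body and the pairing inequality for the dual gauge *)

Section DualGauge.
Context {R : realType} {X : vectType R} {w : {skew_symmetric X}}.
Context (hw : is_psymplectic w) {g : X -> R} (hg : is_gauge g).

Lemma symp_linear v : linear (w v : X -> R^o).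
Proof.
move=> a x y; rewrite [LHS]skewE linearPl /= opprD -mulrN.
by rewrite -!skewE.
Qed.

Lemma sympZl a x y : w (a *: x) y = a * w x y.
Proof. by rewrite linearZl_LR. Qed.

(** Rescaling [z] by [(g z)^-1] puts it in the unit ball, which turns the polar condition into
    domination by [g] on the whole space. *)
Lemma mem_dual_body v :
  dual_body w (unit_ball g) v <-> (forall z, w v z <= g z).
Proof.
split=> [[f fP <-] z|vP].
  rewrite -(symp_isoE hw).
  have [->|z0] := eqVneq z 0; first by rewrite linear0 (gauge_ge0 hg).
  have gz := gauge_gt0 hg z0.
  have : (f ((g z)^-1 *: z) : R) <= 1.
    apply: fP; rewrite /unit_ball /= (gaugeZ hg) ?invr_ge0 ?(ltW gz)//.
    by rewrite mulVf ?gt_eqF.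
  by rewrite linearZ /= ler_pdivrMl// mulr1.
have [f fE] := linear_hom (symp_linear v).
exists f => [z gz|]; first by rewrite fE; exact: le_trans gz.
by apply: (symp_iso_unique hw) => z; rewrite -symp_isoE.
Qed.

Lemma dual_gauge_le v c : 0 < c -> (forall z, w v z <= c * g z) ->
  dual_gauge w g v <= c.
Proof.
move=> c0 vc; apply: ge_inf; first by exists 0 => l [].
split; first exact: ltW.
exists (c^-1 *: v); last by rewrite scalerA divff ?gt_eqF// scale1r.
by apply/mem_dual_body => z; rewrite sympZl ler_pdivrMl.
Qed.

(** A Cauchy-Schwarz inequality for the pair of gauges: each [l] with [v] in [l] times the dual body
    is at least [w v z / g z], hence so is the infimum. *)
Lemma symp_le_dual_gauge v z : w v z <= dual_gauge w g v * g z.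
Proof.
have [->|z0] := eqVneq z 0.
  by rewrite ((gauge_eq0 hg 0).2 erefl) mulr0 skewE linear0l oppr0.
have gz := gauge_gt0 hg z0.
rewrite -ler_pdivrMr//; apply: lb_le_inf.
  (* Finiteness of the dual gauge: otherwise [inf set0 = 0]. *)
  have [|C C0 vC] := @sublinear_le_gauge _ _ g (w v) hg.
    have [f fE] := linear_hom (symp_linear v).
    by split=> [a u _|u u']; rewrite -!fE ?linearZ ?linearD.
  exists C; split; first exact: ltW.
  exists (C^-1 *: v); last by rewrite scalerA divff ?gt_eqF// scale1r.
  by apply/mem_dual_body => u; rewrite sympZl ler_pdivrMl.
move=> l [l0 [k /mem_dual_body kP <-]].
by rewrite ler_pdivrMr// sympZl ler_wpM2l.
Qed.

End DualGauge.

(** * Transfer of orthogonality from the dual gauge to the gauge *)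

Theorem theorem6p2 (R : realType) (X : vectType R)
  (hX : ~~ odd (\dim {:X}))
  (g : X -> R) (hg : is_gauge g)
  (w : {skew_symmetric X}) (hw : is_psymplectic w)
  (x y : X) (hx : x != 0) (hy : y != 0)
  (hyx : gauge_orth_subspace (dual_gauge w g) y (symp_compl w x))
  (hxy : 0 < w x y) :
  gauge_orth_subspace g (- x) (symp_compl w y).
Proof.
have gx : 0 < g (- x) by rewrite gauge_gt0// oppr_eq0.
have [f [fg fx]] := supporting_functional (- x) (gauge_sublinear hg).
have wf z : w (symp_iso w f) z = f z by rewrite -symp_isoE.
(* Since [f x = - g (- x)], this factor gives [c *: symp_iso w f] the same pairing with [x] as [y]
   has. *)
pose c := w x y / g (- x); have c0 : 0 < c by exact: divr_gt0.
have cg : c * g (- x) = w x y by rewrite divfK// gt_eqF.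
pose v := c *: symp_iso w f.
have dual_y : dual_gauge w g y <= c.
  have vy : v - y \in symp_compl w x.
    rewrite mem_symp_compl skewE linearBl /= sympZl wf (_ : f x = - g (- x)).
      by rewrite (skewE w y x) mulrN opprK cg addNr oppr0.
    by rewrite -fx linearN opprK.
  have := hyx _ vy 1; rewrite scale1r addrC subrK => /le_trans; apply.
  by apply: dual_gauge_le => // z; rewrite sympZl wf ler_pM2l.
move=> z; rewrite mem_symp_compl => /eqP yz t.
have : w x y <= dual_gauge w g y * g (- x + t *: z).
  have <- : w y (- x + t *: z) = w x y.
    by rewrite addrC symp_linear yz scaler0 add0r skewE linearNl /= opprK.
  exact: symp_le_dual_gauge.
move=> /le_trans /(_ (ler_wpM2r (gauge_ge0 hg _) dual_y)).
by rewrite /c mulrAC ler_pdivlMr// ler_pM2l.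
Qed.
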